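(* For $d\ge2$, $\operatorname{Mult}(H^2(\mathfrak{D}_d))=\{c1:c\in\mathbb{C}\}$, where $1$ is the constant function.
   Context: $M_n^d$ is the set of $d$-tuples of complex $n\times n$ matrices; $\mathbb{M}^d=\sqcup_{n\ge1}M_n^d$. The nc unit polydisk is $\mathfrak{D}_d=\sqcup_n\{X\in M_n^d:\max_j\|X_j\|<1\}$. A nc function $f:\mathfrak{D}_d\to\mathbb{M}^1$ is a graded map (sending $d$-tuples of $n\times n$ matrices to $n\times n$ matrices) with $f(X\oplus Y)=f(X)\oplus f(Y)$ and $f(S^{-1}XS)=S^{-1}f(X)S$ whenever $S\in GL_n$ and $X,S^{-1}XS\in\mathfrak{D}_d(n)=\mathfrak{D}_d\cap M_n^d$. $\mathbb{F}_d^+$ is the free monoid of words $\alpha=\alpha_1\cdots\alpha_k$ in letters $1,\dots,d$, $|\alpha|=k$, $Z^\alpha=Z_{\alpha_1}\cdots Z_{\alpha_k}$; $\alpha!=\tilde\alpha_1!\cdots\tilde\alpha_d!$ where $\tilde\alpha_j$ is the number of occurrences of the letter $j$ in $\alpha$. The nc Hardy space is $$H^2(\mathfrak{D}_d)=\Big\{f\sim\sum_{\alpha\in\mathbb{F}_d^+}c_\alpha Z^\alpha:\ \sum_{\alpha\in\mathbb{F}_d^+}\frac{|\alpha|!}{\alpha!}|c_\alpha|^2<\infty\Big\}$$ with inner product $\langle\sum c_\alpha Z^\alpha,\sum d_\alpha Z^\alpha\rangle=\sum_\alpha\frac{|\alpha|!}{\alpha!}\overline{d_\alpha}c_\alpha$;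 these series converge absolutely at every point of $\mathfrak{D}_d$, and $H^2(\mathfrak{D}_d)$ is a Hilbert space of nc functions on $\mathfrak{D}_d$ with bounded point evaluations $f\mapsto\langle f(X)v,u\rangle$. $\operatorname{Mult}(H^2(\mathfrak{D}_d))$ is the set of nc functions $\phi:\mathfrak{D}_d\to\mathbb{M}^1$ such that the pointwise product $\phi\cdot h$ (i.e. $X\mapsto\phi(X)h(X)$) lies in $H^2(\mathfrak{D}_d)$ for every $h\in H^2(\mathfrak{D}_d)$. *)

(* Defs.v *)
From HB Require Import structures.
From mathcomp Require Import all_boot all_order all_algebra.
From mathcomp Require Import finmap.
From mathcomp Require Import boolp classical_sets reals ereal topology.
From mathcomp Require Import normedtype esum.
From mathcomp.analysis.showcase Require Import summability.
From mathcomp Require Import complex.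

Set Implicit Arguments.
Unset Strict Implicit.
Unset Printing Implicit Defensive.
Import Order.TTheory GRing.Theory Num.Theory.
Import numFieldNormedType.Exports.
Local Open Scope classical_set_scope.
Local Open Scope ring_scope.

Section NcHardy.
Variables (R : realType) (d : nat).
Local Notation C := R[i].

Definition l2norm n (v : 'cV[C]_n) : R :=
  Num.sqrt (\sum_i Normc.normc (v i 0) ^+ 2).

Definition opnorm n (A : 'M[C]_n) : R :=
  sup [set l2norm (A *m v) | v in [set v | l2norm v <= 1]].

(* Sizes start at 1, so the level at size 0 is empty and carries no data. *)
Definition polydisk n : set ('I_d -> 'M[C]_n) :=
  [set X | (0 < n)%N /\ \big[Num.max/0]_(j < d) opnorm (X j) < 1].
Arguments polydisk : clear implicits.

(* A level of the polydisk is used as a type, so that two graded maps are equal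
   as soon as they agree at every point of the polydisk. *)
Definition graded_map := forall n, polydisk n -> 'M[C]_n.

(* The polydisk is closed under direct sums, so the point [W] of the first
   clause exists for all [X] and [Y]. *)
Definition nc_function (f : graded_map) :=
  (forall m n (X : polydisk m) (Y : polydisk n) (W : polydisk (m + n)),
     (forall j, val W j = block_mx (val X j) 0 0 (val Y j)) ->
     f (m + n)%N W = block_mx (f m X) 0 0 (f n Y)) /\
  (forall n (S : 'M[C]_n) (X Y : polydisk n), S \in unitmx ->
     (forall j, val Y j = invmx S *m val X j *m S) ->
     f n Y = invmx S *m f n X *m S).

Definition word := seq 'I_d.

Definition word_prod n (X : 'I_d -> 'M[C]_n) (a : word) : 'M[C]_n :=
  \big[mulmx/1%:M]_(j <- a) X j.

(* |a|! / a!, where a! is the product of the factorials of the letter counts. *)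
Definition multinom (a : word) : R :=
  (size a)`!%:R / (\prod_(j < d) (count_mem j a)`!)%:R.

Definition square_summable (c : word -> C) : Prop :=
  (\esum_(a in [set: word]) (multinom a * Normc.normc (c a) ^+ 2)%:E < +oo)%E.

(* Sums over words are limits along the finite sets of words ordered by
   inclusion, i.e. unordered (for matrices, absolutely convergent) sums. *)
Definition has_expansion (f : graded_map) (c : word -> C) : Prop :=
  forall n (X : polydisk n),
    partial_sum (fun a : word => c a *: word_prod (val X) a) @ totally
      --> (f n X : 'M[C^o]_n).

Definition H2 : set graded_map :=
  [set f | exists c, square_summable c /\ has_expansion f c].

Definition Mult : set graded_map :=
  [set phi | nc_function phi /\
    forall h, H2 h -> H2 (fun n X => phi n X *m h n X)].

Definition nc_one : graded_map := fun n _ => 1%:M.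

End NcHardy.
Arguments polydisk : clear implicits.
Arguments H2 : clear implicits.
Arguments Mult : clear implicits.
Arguments nc_one : clear implicits.

(* Main.v *)
(* Evaluating at the weighted shift along a word g (the matrices with entries
   1/2 at (i, i+1) when the i-th letter of g is j) reads off the coefficient of
   g as a corner entry, so coefficients are unique and those of a product are
   convolutions.  Let f be a multiplier with coefficients c; then f = f * 1 is
   in H^2.  If some c b with b nonempty is nonzero, pick a letter i of b, take b
   of minimal length among words containing i with nonzero coefficient, and let
   j <> i.  For h = sum_N a_N Z_j^N with |a_N| = 1/(N+1), the coefficient of
   f * h at b j^N is sum_(s <= N) c (b j^s) a_(N-s), and the signs of the a_N
   can be chosen one after the other so that it has modulus at least |c b|/(N+1).
   The weight of b j^N grows at least linearly in N while Z_j^N has norm 1, so h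
   is in H^2 but the norm of f * h dominates the harmonic series. *)
Require Import Defs.
From mathcomp Require Import all_boot all_order all_algebra.
From mathcomp Require Import boolp classical_sets reals complex.
From mathcomp Require Import finmap cardinality fsbigop ereal topology.
From mathcomp Require Import normedtype sequences esum.
From mathcomp.analysis.showcase Require Import summability.
From mathcomp Require Import ring lra zify.
Import Order.TTheory GRing.Theory Num.Theory Normc.
Import numFieldNormedType.Exports.
Local Open Scope classical_set_scope.
Local Open Scope ring_scope.

Set Implicit Arguments.
Unset Strict Implicit.
Unset Printing Implicit Defensive.

(** * Modulus of complex numbers and unordered convergence of sums *)

Lemma le_Re_normc (R : rcfType) (z : R[i]) : `|complex.Re z| <= normc z.
Proof. by have := normc_ge_Re z; rewrite -lecR. Qed.

Lemma le_Im_normc (R : rcfType) (z : R[i]) : `|complex.Im z| <= normc z.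
Proof.
have := le_Re_normc (z * 'i%C).
by rewrite ReiNIm normrN normcM /= expr0n expr1n add0r sqrtr1 mulr1.
Qed.

Lemma normc_le_ReIm (R : rcfType) (z : R[i]) :
  normc z <= `|complex.Re z| + `|complex.Im z|.
Proof.
rewrite -(@ler_pXn2r _ 2) ?nnegrE ?addr_ge0 //; last first.
  by case: z => a b; rewrite sqrtr_ge0.
case: z => a b /=; rewrite sqr_sqrtr ?addr_ge0 ?sqr_ge0 //.
rewrite sqrrD !real_normK ?num_real //.
have : 0 <= `|a| * `|b| by rewrite mulr_ge0.
lra.
Qed.

Lemma normc_ge0 (R : rcfType) (z : R[i]) : 0 <= normc z.
Proof. by case: z => a b; rewrite sqrtr_ge0. Qed.

Lemma normcR (R : rcfType) (x : R) : normc x%:C%C = `|x|.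
Proof. by rewrite /= expr0n addr0 sqrtr_sqr. Qed.

Lemma normc_sum (R : rcfType) (I : Type) (r : seq I) (F : I -> R[i]) :
  normc (\sum_(i <- r) F i) <= \sum_(i <- r) normc (F i).
Proof.
elim/big_rec2: _ => [|i x y _ le_xy]; first by rewrite normc0.
by rewrite (le_trans (le_normcD _ _)) // lerD2l.
Qed.

(** Balls of matrices are entrywise, so one finite set serves all entries at once and the topology
    can be left aside. *)
Lemma mx_partial_sumP (R : realType) (I : choiceType) m n
    (F : I -> 'M[R[i]]_(m, n)) (L : 'M[R[i]]_(m, n)) :
  partial_sum F @ totally --> (L : 'M[(R[i])^o]_(m, n)) <->
  forall e : R, 0 < e -> exists J0 : {fset I}, forall J : {fset I},
    (J0 `<=` J)%fset ->
    forall i k, normc (L i k - \sum_(w <- J) F w i k) < e.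
Proof.
have psE (J : {fset I}) i k : partial_sum F J i k = \sum_(w <- J) F w i k.
  by rewrite /partial_sum summxE -(big_seq_fsetE _ _ xpredT (fun w => F w i k)).
have ballP := @cvg_ballP _ 'M[(R[i])^o]_(m, n) _ totally
  totally_filter (partial_sum F : {fset I} -> 'M[(R[i])^o]_(m, n)) L.
split=> [/ballP cvL e e0|cvL].
  have /cvL[J0 _ J0P] : 0 < e%:C%C by rewrite ltcR.
  exists J0 => J J0J i k; have [_ /(_ i k)] := J0P J J0J.
  by rewrite psE /ball /= -ltcR.
apply/ballP => e e0.
(* Radii of balls live in [R[i]]; a positive one is real, hence equal to its real part. *)
have eE : e = (complex.Re e)%:C%C by rewrite RRe_real // gtr0_real.
have /cvL[J0 J0P] : 0 < complex.Re e by rewrite -ltcR -eE.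
exists J0 => // J J0J; split => // i k; move: (J0P J J0J i k).
by rewrite /= psE [in X in _ -> X]eE /ball /= ltcR.
Qed.

(** A nonnegative family converges to the supremum of its finite sums; a signed [x] is the
    difference of the nonnegative families [|x| + x] and [|x|]. *)
Lemma fset_sum_cvg (R : realType) (I : choiceType) (x : I -> R) (M : R) :
  (forall J : {fset I}, \sum_(w <- J) `|x w| <= M) ->
  exists l : R, forall e : R, 0 < e -> exists J0 : {fset I}, forall J : {fset I},
    (J0 `<=` J)%fset -> `|l - \sum_(w <- J) x w| < e.
Proof.
have pos (y : I -> R) (B : R) : (forall w, 0 <= y w) ->
    (forall J : {fset I}, \sum_(w <- J) y w <= B) ->
  exists l : R, forall e : R, 0 < e -> exists J0 : {fset I}, forall J : {fset I},
    (J0 `<=` J)%fset -> `|l - \sum_(w <- J) y w| < e.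
  move=> y0 yB; pose S := [set \sum_(w <- J) y w | J in [set: {fset I}]].
  have supS : has_sup S.
    split; first by exists (\sum_(w <- fset0) y w), fset0.
    by exists B => _ [J _ <-].
  exists (sup S) => e e0; have [_ [J0 _ <-] ltJ0] := sup_adherent e0 supS.
  exists J0 => J J0J.
  have ubJ : \sum_(w <- J) y w <= sup S.
    by apply: ub_le_sup; [case: supS | exists J].
  rewrite ger0_norm ?subr_ge0 // ltrBlDr -ltrBlDl; apply: lt_le_trans.
    exact: ltJ0.
  rewrite (@big_fsetID _ _ _ _ (fun w => w \in J0) J y) /=.
  rewrite (_ : [fset w in J | w \in J0]%fset = J0) ?lerDl ?sumr_ge0 //.
  apply/fsetP => w; rewrite !inE /= andbC.
  by case: (boolP (w \in J0)) => //= /(fsubsetP J0J).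
move=> xM.
have [w|J|l1 l1P] := pos (fun w => `|x w| + x w) (M + M).
- by have := ler_norm (- x w); rewrite normrN; lra.
- rewrite big_split lerD // (le_trans _ (xM J)) // ler_sum // => w _.
  exact: ler_norm.
have [w|J|l2 l2P] := pos (fun w => `|x w|) M => //.
exists (l1 - l2) => e e0; have e2 : 0 < e / 2 by rewrite divr_gt0.
have [J1 J1P] := l1P _ e2; have [J2 J2P] := l2P _ e2.
exists (J1 `|` J2)%fset => J; rewrite fsubUset => /andP[/J1P + /J2P].
rewrite big_split /= !ltr_norml => /andP[? ?] /andP[? ?]; apply/andP; split; lra.
Qed.

Lemma complex_fset_sum_cvg (R : realType) (I : choiceType) (z : I -> R[i]) (M : R) :
  (forall J : {fset I}, \sum_(w <- J) normc (z w) <= M) ->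
  exists l : R[i], forall e : R, 0 < e -> exists J0 : {fset I}, forall J : {fset I},
    (J0 `<=` J)%fset -> normc (l - \sum_(w <- J) z w) < e.
Proof.
move=> zM.
have [J|lr lrP] := @fset_sum_cvg R I (fun w => complex.Re (z w)) M.
  by rewrite (le_trans _ (zM J)) // ler_sum // => w _; exact: le_Re_normc.
have [J|li liP] := @fset_sum_cvg R I (fun w => complex.Im (z w)) M.
  by rewrite (le_trans _ (zM J)) // ler_sum // => w _; exact: le_Im_normc.
exists (lr +i* li)%C => e e0; have e2 : 0 < e / 2 by rewrite divr_gt0.
have [J1 J1P] := lrP _ e2; have [J2 J2P] := liP _ e2.
exists (J1 `|` J2)%fset => J; rewrite fsubUset => /andP[/J1P ltr /J2P lti].
apply: le_lt_trans (normc_le_ReIm _) _; rewrite [e]splitr.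
have -> : \sum_(w <- J) z w =
    ((\sum_(w <- J) complex.Re (z w)) +i* (\sum_(w <- J) complex.Im (z w)))%C.
  elim: (enum_fset J) => [|w s IH]; first by rewrite !big_nil.
  by rewrite !big_cons IH; case: (z w).
exact: ltrD.
Qed.

(** * Euclidean norm of columns and operator norm of matrices *)

Section L2norm.
Variables (R : realType).
Local Notation C := R[i].

Lemma sum_normc_ge0 n (v : 'cV[C]_n) : 0 <= \sum_i normc (v i 0) ^+ 2.
Proof. by rewrite sumr_ge0 // => i _; rewrite sqr_ge0. Qed.

Lemma l2norm_ge0 n (v : 'cV[C]_n) : 0 <= l2norm v.
Proof. exact: sqrtr_ge0. Qed.

Lemma sqr_l2norm n (v : 'cV[C]_n) : l2norm v ^+ 2 = \sum_i normc (v i 0) ^+ 2.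
Proof. by rewrite sqr_sqrtr // sum_normc_ge0. Qed.

Lemma l2normZ n (z : C) (v : 'cV[C]_n) : l2norm (z *: v) = normc z * l2norm v.
Proof.
apply/eqP; rewrite -(@eqrXn2 _ 2) ?mulr_ge0 ?normc_ge0 ?l2norm_ge0 //.
rewrite exprMn !sqr_l2norm mulr_sumr; apply/eqP/eq_bigr => i _.
by rewrite mxE normcM exprMn.
Qed.

Lemma normc_le_l2norm n (v : 'cV[C]_n) i : normc (v i 0) <= l2norm v.
Proof.
rewrite -(@ler_pXn2r _ 2) ?nnegrE ?normc_ge0 ?l2norm_ge0 // sqr_l2norm.
by rewrite (bigD1 i) //= lerDl sumr_ge0 // => k _; rewrite sqr_ge0.
Qed.

Lemma l2norm_eq0 n (v : 'cV[C]_n) : l2norm v = 0 -> v = 0.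
Proof.
move=> v0; apply/colP => i; rewrite mxE; apply: eq0_normc; apply/eqP.
by rewrite eq_le normc_ge0 -[leRHS]v0 normc_le_l2norm.
Qed.

Lemma l2norm0 n : l2norm (0 : 'cV[C]_n) = 0.
Proof. by rewrite -[0 in LHS](scale0r 0) l2normZ normc0 mul0r. Qed.

Lemma l2norm_delta n (k : 'I_n) : l2norm (delta_mx k 0 : 'cV[C]_n) = 1.
Proof.
apply/eqP; rewrite -(@eqrXn2 _ 2) ?l2norm_ge0 // sqr_l2norm (bigD1 k) //=.
rewrite big1 => [|i /negPf ik]; first by rewrite mxE !eqxx normc1 expr1n addr0.
by rewrite mxE ik normc0 expr0n.
Qed.

Lemma opnorm_le n (A : 'M[C]_n) (q : R) :
  (forall v, l2norm v <= 1 -> l2norm (A *m v) <= q) -> opnorm A <= q.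
Proof.
move=> Aq; apply: ge_sup => [|_ [v v1 <-]]; last exact: Aq.
by exists (l2norm (A *m 0)), 0; rewrite //= l2norm0.
Qed.

Lemma le_opnorm1 n (A : 'M[C]_n) v : l2norm v <= 1 -> l2norm (A *m v) <= opnorm A.
Proof.
move=> v1; apply: ub_le_sup; last by exists v.
(* Each coordinate of [u] has modulus at most 1, so row sums of moduli bound the image; the [sup] is
   then a genuine upper bound. *)
exists (Num.sqrt (\sum_i (\sum_k normc (A i k)) ^+ 2)) => _ [u u1 <-].
apply: ler_wsqrtr; apply: ler_sum => i _.
rewrite ler_pXn2r ?nnegrE ?normc_ge0 ?sumr_ge0 // => [|k _]; last exact: normc_ge0.
rewrite mxE (le_trans (normc_sum _ _)) // ler_sum // => k _.
by rewrite normcM ler_piMr ?normc_ge0 // (le_trans (normc_le_l2norm _ _)).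
Qed.

Lemma le_opnorm n (A : 'M[C]_n) v : l2norm (A *m v) <= opnorm A * l2norm v.
Proof.
have [/eqP v0|v0] := boolP (l2norm v == 0).
  by rewrite (l2norm_eq0 v0) mulmx0 !l2norm0 mulr0.
have v_gt0 : 0 < l2norm v by rewrite lt_def v0 l2norm_ge0.
rewrite -ler_pdivrMr // mulrC.
have -> : (l2norm v)^-1 = normc ((l2norm v)^-1)%:C%C.
  by rewrite normcR ger0_norm // invr_ge0 l2norm_ge0.
rewrite -l2normZ scalemxAr le_opnorm1 // l2normZ normcR.
by rewrite ger0_norm ?invr_ge0 ?l2norm_ge0 // mulVf.
Qed.

Lemma opnorm_ge0 n (A : 'M[C]_n) : 0 <= opnorm A.
Proof.
have := @le_opnorm1 n A 0; rewrite l2norm0 mulmx0 l2norm0.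
exact.
Qed.

Lemma l2norm_word_prod_nseq d n (X : 'I_d -> 'M[C]_n) j m (v : 'cV[C]_n) :
  l2norm (word_prod X (nseq m j) *m v) <= opnorm (X j) ^+ m * l2norm v.
Proof.
elim: m => [|m IH]; first by rewrite /word_prod big_nil mul1mx expr0 mul1r.
rewrite /word_prod /= big_cons -mulmxA (le_trans (le_opnorm _ _)) //.
by rewrite exprS -mulrA ler_wpM2l ?opnorm_ge0.
Qed.

Lemma normc_word_prod_nseq d n (X : 'I_d -> 'M[C]_n) j m i k :
  normc (word_prod X (nseq m j) i k) <= opnorm (X j) ^+ m.
Proof.
have -> : word_prod X (nseq m j) i k =
    (word_prod X (nseq m j) *m delta_mx k 0 : 'cV_n) i 0.
  by rewrite -colE mxE.
apply: le_trans (normc_le_l2norm _ _) _.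
by rewrite (le_trans (l2norm_word_prod_nseq _ _ _ _)) // l2norm_delta mulr1.
Qed.

End L2norm.

(** * Weighted shifts along a word *)

Section Shift.
Variables (R : realType) (d : nat).
Local Notation C := R[i].
Implicit Types (g w : word d).

(** Letters are counted from 0. At [i = size g] the [ohead] is [None], so the last row vanishes. *)
Definition shift_mx g (j : 'I_d) : 'M[C]_((size g).+1) :=
  \matrix_(i, k) if (k == i.+1 :> nat) && (ohead (drop i g) == Some j)
                 then 2^-1 else 0.

(** Each letter of [w] moves the row index one step to the right, and only if it is the next letter
    of [g]; so [w] leads from [i] to [k] only when it spells the stretch of [g] between them. *)
Lemma shift_word_prod g w (i k : 'I_(size g).+1) :
  word_prod (shift_mx g) w i k =
  if (i <= k)%N && (w == take (k - i) (drop i g)) then 2^-1 ^+ size w else 0.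
Proof.
elim: w i k => [|j w IH] i k.
  rewrite /word_prod big_nil mxE expr0.
  have -> : ([::] == take (k - i) (drop i g)) = (k <= i)%N.
    rewrite eq_sym -size_eq0 size_takel ?subn_eq0 //.
    by rewrite size_drop leq_sub2r // -ltnS.
  by rewrite -eqn_leq val_eqE; case: (i == k).
rewrite /word_prod big_cons mxE.
case dg: (drop i g) => [|x s].
  rewrite big1 ?andbF // => l _; rewrite mxE dg andbF mul0r //.
have ig : (i < size g)%N.
  by rewrite ltnNge; apply/negP => /drop_oversize; rewrite dg.
have dSg : drop i.+1 g = s by rewrite -addn1 addnC -drop_drop dg /= drop0.
have iS : (i.+1 < (size g).+1)%N by [].
(* Row [i] of the first factor has its only possible nonzero entry in column [i.+1]. *)
rewrite (bigD1 (Ordinal iS)) //= big1 => [|l /negPf li]; last first.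
  rewrite mxE; case: eqP => [li'|]; last by rewrite mul0r.
  by move: li; rewrite -val_eqE /= li' eqxx.
rewrite addr0 -/(word_prod _ _) IH mxE /= dg eqxx /= dSg.
case: (ltngtP i k) => [ik|ki|ik]; last 2 first.
- by rewrite mulr0.
- by rewrite ik subnn take0 mulr0.
rewrite -(subnSK ik) /= eqseq_cons [j == x]eq_sym (inj_eq Some_inj).
by case: (x == j); case: (w == _); rewrite ?mulr0 ?mul0r // exprS.
Qed.

(** Coordinate [i] of the image is at most half of coordinate [i.+1] of [v], and the last one is 0,
    so no coordinate of [v] is used twice. *)
Lemma opnorm_shift g j : opnorm (shift_mx g j) <= 2^-1.
Proof.
apply: opnorm_le => v v1.
rewrite -(@ler_pXn2r _ 2) ?nnegrE ?invr_ge0 ?l2norm_ge0 ?ler0n // sqr_l2norm.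
have shiftE (i : 'I_(size g)) :
    normc ((shift_mx g j *m v) (widen_ord (leqnSn _) i) 0) <=
    2^-1 * normc (v (lift ord0 i) 0).
  rewrite mxE (bigD1 (lift ord0 i)) //= big1 => [|l /negPf li]; last first.
    rewrite mxE; case: eqP => [li'|]; last by rewrite mul0r.
    by move: li; rewrite -val_eqE /= li' eqxx.
  rewrite addr0 mxE lift0 /= eqxx /=; case: ifP => _.
    have -> : 2^-1 = (2^-1 : R)%:C%C by rewrite fmorphV rmorph_nat.
    by rewrite normcM normcR ger0_norm ?invr_ge0.
  by rewrite mul0r normc0 mulr_ge0 ?invr_ge0 ?normc_ge0.
rewrite big_ord_recr /= [X in _ + X](_ : _ = 0) ?addr0; last first.
  rewrite mxE big1 ?normc0 ?expr0n // => l _.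
  by rewrite mxE /= drop_size andbF mul0r.
apply: (@le_trans _ _ (\sum_(i < size g) (2^-1 * normc (v (lift ord0 i) 0)) ^+ 2)).
  by apply: ler_sum => i _; rewrite ler_pXn2r ?nnegrE ?mulr_ge0 ?invr_ge0 ?normc_ge0.
under eq_bigr do rewrite exprMn; rewrite -mulr_sumr ler_piMr ?sqr_ge0 //.
have := sqr_l2norm v; rewrite big_ord_recl /= => sqv.
have : l2norm v ^+ 2 <= 1 by rewrite expr_le1 ?l2norm_ge0.
by rewrite sqv; apply: le_trans; rewrite lerDr sqr_ge0.
Qed.

End Shift.

(** * Coefficients of expansions, of products, and square summability *)

Section Expansion.
Variables (R : realType) (d : nat).
Local Notation C := R[i].
Implicit Types (g w : word d) (c e : word d -> C).

Lemma shift_in_polydisk g :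
  exists X : polydisk R d (size g).+1, val X = shift_mx R g.
Proof.
have Xg : shift_mx R g \in polydisk R d (size g).+1.
  apply/mem_set; split=> //; apply: bigmax_lt => // j _.
  by rewrite (le_lt_trans (opnorm_shift _ _ _)) // invf_lt1 // ltr1n.
by exists (@exist _ _ (shift_mx R g) Xg).
Qed.

Lemma expansion_shift (f : graded_map R d) c g (X : polydisk R d (size g).+1)
    (i k : 'I_(size g).+1) :
  has_expansion f c -> val X = shift_mx R g -> (i <= k)%N ->
  f _ X i k = c (take (k - i) (drop i g)) * 2^-1 ^+ (k - i).
Proof.
move=> /(_ _ X)/mx_partial_sumP fc Xg ik; set w := take _ _.
apply/eqP; rewrite -subr_eq0; apply/eqP/eq0_normc/eqP.
(* Only the word [w] contributes to this entry, so the finite sums are constant once they contain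
   [w]. Were the entry different, the modulus of the difference, taken as the tolerance, would be
   smaller than itself. *)
rewrite eq_le normc_ge0 andbT leNgt; apply/negP => /fc[J0].
move=> /(_ (w |` J0)%fset (fsubsetUr _ _) i k).
rewrite (bigD1_seq w) ?fset_uniq ?inE ?eqxx //= big1 => [|u /negPf uw].
  rewrite addr0 mxE Xg shift_word_prod ik eqxx /=.
  by rewrite size_takel ?ltxx // size_drop leq_sub2r // -ltnS.
by rewrite mxE Xg shift_word_prod uw andbF mulr0.
Qed.

(** The top right corner of a product of two matrices sums over the middle index [l], which is the
    place where [g] is cut in two; every term carries the same power of 1/2, which cancels. *)
Lemma coef_mul (p h : graded_map R d) c e b g :
  has_expansion p c -> has_expansion h e ->
  has_expansion (fun n X => p n X *m h n X) b ->
  b g = \sum_(l < (size g).+1) c (take l g) * e (drop l g).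
Proof.
move=> pc he phb; have [X Xg] := shift_in_polydisk g.
have r0 : (2^-1 : C) ^+ size g != 0 by rewrite expf_neq0 // invr_eq0 pnatr_eq0.
apply: (mulIf r0); rewrite mulr_suml.
have := expansion_shift (i := ord0) (k := ord_max) phb Xg (leq0n _).
rewrite subn0 drop0 take_size => <-; rewrite mxE; apply: eq_bigr => l _.
have lg : (l <= size g)%N by rewrite -ltnS.
rewrite (expansion_shift (i := ord0) (k := l) pc Xg (leq0n _)).
rewrite (expansion_shift (i := l) (k := ord_max) he Xg (leq_ord l)).
rewrite subn0 drop0 /= [take (size g - l) _]take_oversize ?size_drop // mulrACA -exprD.
by rewrite subnKC.
Qed.

Lemma square_summableP c :
  square_summable c <-> exists B : R, forall J : {fset word d},
    \sum_(w <- J) multinom R w * normc (c w) ^+ 2 <= B.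
Proof.
have EJ (J : {fset word d}) :
    (\sum_(w \in [set` J]) (multinom R w * normc (c w) ^+ 2)%:E)%E =
    (\sum_(w <- J) multinom R w * normc (c w) ^+ 2)%:E.
  by rewrite fsbig_finite ?finite_fset //= set_fsetK sumEFin.
have Fge0 w : (0 <= (multinom R w * normc (c w) ^+ 2)%:E)%E.
  by rewrite lee_fin mulr_ge0 ?sqr_ge0 // mulr_ge0 ?invr_ge0 ?ler0n.
split=> [sc|[B cB]].
  exists (fine (\esum_(w in [set: word d]) (multinom R w * normc (c w) ^+ 2)%:E)%E).
  move=> J; rewrite -lee_fin fineK; last by rewrite ge0_fin_numE ?esum_ge0.
  by rewrite -EJ; apply: esum_ge; exists [set` J].
apply: (@le_lt_trans _ _ B%:E); last exact: ltry.
apply: ge_ereal_sup => _ [A [finA _] <-].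
by rewrite -(fset_setK finA) EJ lee_fin.
Qed.

End Expansion.

(** * Power series in a single variable *)

Section PowerSeries.
Variables (R : realType) (d : nat).
Local Notation C := R[i].
Implicit Types (w : word d).

Lemma fset_sum_nseq_le (J : {fset word d}) (j : 'I_d) (f : nat -> R) (B : R) :
  (forall m, 0 <= f m) -> (forall M, \sum_(m < M) f m <= B) ->
  \sum_(w <- J) (if w == nseq (size w) j then f (size w) else 0) <= B.
Proof.
(* [M] exceeds all lengths in [J], so each term can be spread over [m < M]; after exchanging the
   sums, each power of [j] is met at most once. *)
move=> f0 fB; pose M := (\max_(w <- J) size w).+1.
have -> : \sum_(w <- J) (if w == nseq (size w) j then f (size w) else 0) =
    \sum_(w <- J) \sum_(m < M) (if w == nseq m j then f m else 0).
  apply: eq_big_seq => w wJ.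
  have wM : (size w < M)%N by rewrite ltnS leq_bigmax_seq.
  rewrite (bigD1 (Ordinal wM)) //= big1 ?addr0 // => m.
  rewrite -val_eqE /= => /negPf mw; case: eqP => // wm.
  by move: mw; rewrite wm size_nseq eqxx.
rewrite exchange_big /= (le_trans _ (fB M)) // ler_sum // => m _.
have [mJ|mJ] := boolP (nseq m j \in J).
  rewrite (bigD1_seq _ mJ) ?fset_uniq //= eqxx big1 ?addr0 // => w /negPf -> //.
rewrite big_seq big1 // => w wJ; case: eqP => // wm.
by move: mJ; rewrite -wm wJ.
Qed.

Lemma geometric_sum_le (q : R) M : 0 <= q -> q < 1 ->
  \sum_(m < M) q ^+ m <= (1 - q)^-1.
Proof.
move=> q0 q1; have q1' : 0 < 1 - q by rewrite subr_gt0.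
rewrite -[leRHS]mul1r ler_pdivlMr //.
have := subrX1 q M; have : 0 <= q ^+ M by rewrite exprn_ge0.
by nra.
Qed.

Lemma inv_square_sum_le M : \sum_(m < M) (m.+1%:R^-1 : R) ^+ 2 <= 2.
Proof.
case: M => [|M]; first by rewrite big_ord0.
(* The sharper bound makes the induction telescope: 1/(m+1)^2 is at most 1/m - 1/(m+1). *)
suff : \sum_(m < M.+1) (m.+1%:R^-1 : R) ^+ 2 <= 2 - M.+1%:R^-1.
  by move=> leM; rewrite (le_trans leM) // gerBl invr_ge0.
elim: M => [|M IH]; first by rewrite big_ord1 invr1; lra.
rewrite big_ord_recr /= (le_trans (lerD IH (lexx _))) //.
have x0 : (M.+1%:R : R) != 0 by rewrite pnatr_eq0.
have y0 : (M.+2%:R : R) != 0 by rewrite pnatr_eq0.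
have : (M.+2%:R : R)^-1 <= M.+1%:R^-1.
  by rewrite lef_pV2 ?posrE ?ltr0n // ler_nat.
have : 0 <= (M.+2%:R : R)^-1 by rewrite invr_ge0.
have : (M.+1%:R : R)^-1 = M.+2%:R^-1 + M.+1%:R^-1 * M.+2%:R^-1.
  by move: x0 y0; rewrite -(natr1 M.+1); move: (M.+1%:R) => x x0 y0;
    field; rewrite y0.
move: (M.+1%:R^-1) (M.+2%:R^-1) => x y; nra.
Qed.

(** The coefficients of the series sum_N a_N Z_j^N: the test says that [w] is a power of the letter
    [j]. *)
Definition power_coef (j : 'I_d) (a : nat -> C) (w : word d) : C :=
  if w == nseq (size w) j then a (size w) else 0.

(** At a point of the polydisk [X j] has norm q < 1, so the entries of the terms are dominated by
    the geometric series of q. *)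
Lemma power_series_exists (j : 'I_d) (a : nat -> C) :
  (forall m, normc (a m) <= 1) ->
  exists h : graded_map R d, has_expansion h (power_coef j a).
Proof.
move=> a1.
suff cvg n (X : polydisk R d n) : exists L : 'M[C]_n,
    partial_sum (fun w => power_coef j a w *: word_prod (val X) w) @ totally
      --> (L : 'M[C^o]_n).
  by exists (fun n X => projT1 (cid (cvg n X))) => n X; case: cid.
set F := fun w => _; pose q := opnorm (val X j).
have q1 : q < 1.
  have /set_mem[_] := valP X; apply: le_lt_trans.
  exact: (le_bigmax _ (fun j => opnorm (val X j))).
have entry i k : exists l : C, forall e : R, 0 < e -> exists J0 : {fset word d},
    forall J, (J0 `<=` J)%fset -> normc (l - \sum_(w <- J) F w i k) < e.
  apply: (@complex_fset_sum_cvg _ _ (fun w => F w i k) (1 - q)^-1) => J.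
  apply: le_trans (@fset_sum_nseq_le J j (fun m => q ^+ m) _ _ _); last 2 first.
  - by move=> m; rewrite exprn_ge0 ?opnorm_ge0.
  - by move=> M; rewrite geometric_sum_le ?opnorm_ge0.
  apply: ler_sum => w _; rewrite mxE normcM /power_coef.
  case: eqP => [->|_]; last by rewrite normc0 mul0r.
  by rewrite size_nseq -[leRHS]mul1r ler_pM ?normc_ge0 ?normc_word_prod_nseq.
pose l i k := projT1 (cid (entry i k)).
have lP i k := projT2 (cid (entry i k)); rewrite -/(l _ _) in lP.
exists (\matrix_(i, k) l i k); apply/mx_partial_sumP => e e0.
pose J i k := projT1 (cid (lP i k e e0)).
have JP i k := projT2 (cid (lP i k e e0)).
(* There are finitely many entries, so the union of their finite sets works for all of them. *)
exists (\bigcup_(i <- enum 'I_n) \bigcup_(k <- enum 'I_n) J i k)%fset => K JK i k.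
rewrite mxE; apply: JP; apply: fsubset_trans JK.
apply: fsubset_trans (bigfcup_sup (j := i) _ _ _); rewrite ?mem_enum //.
by apply: bigfcup_sup; rewrite ?mem_enum.
Qed.

End PowerSeries.

(** * Choosing signs so that a convolution stays large *)

Section Greedy.
Variables (R : realType).
Local Notation C := R[i].

(** The two sums differ by [2v], so they cannot both be shorter than [v]. *)
Lemma normc_le_addsub (u v : C) : normc v <= normc (v + u) \/ normc v <= normc (- v + u).
Proof.
have [|lt1] := leP (normc v) (normc (v + u)); first by left.
have [|lt2] := leP (normc v) (normc (- v + u)); first by right.
have := le_normcD (v + u) (- (- v + u)).
have -> : v + u - (- v + u) = v *+ 2 by ring.
rewrite normcN normcMn mulr2n => le_v.
by have := le_lt_trans le_v (ltrD lt1 lt2); rewrite ltxx.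
Qed.

(* Given the earlier terms, one of the two signs for a_N does not decrease the
   modulus of b_0 a_N when the rest of the convolution is added. *)
Lemma greedy_convolution (b : nat -> C) (r : nat -> R) :
  (forall N, 0 <= r N) ->
  exists a : nat -> C, forall N, normc (a N) = r N /\
    normc (b 0%N) * r N <= normc (\sum_(s < N.+1) b s * a (N - s)%N).
Proof.
move=> r0.
have next (s : seq C) : exists x : C, normc x = r (size s) /\
    normc (b 0%N) * r (size s) <=
      normc (b 0%N * x + \sum_(k < size s) b k.+1 * s`_(size s - k.+1)).
  set u := \sum_(k < _) _; set v := b 0%N * (r (size s))%:C%C.
  have vE : normc (b 0%N) * r (size s) = normc v.
    by rewrite normcM normcR ger0_norm.
  rewrite vE; have [uv|uv] := normc_le_addsub u v.
    by exists (r (size s))%:C%C; rewrite normcR ger0_norm.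
  by exists (- (r (size s))%:C%C); rewrite normcN normcR ger0_norm // mulrN.
have [x xP] := choice next.
(* Course-of-values recursion: [hist N] lists the first [N] chosen terms, and [x] picks the next one
   from that list. *)
pose hist := fix hist N := if N is N'.+1 then rcons (hist N') (x (hist N')) else [::].
have size_hist N : size (hist N) = N.
  by elim: N => //= N IH; rewrite size_rcons IH.
have nth_hist N m : (m < N)%N -> (hist N)`_m = x (hist m).
  elim: N => // N IH; rewrite ltnS leq_eqVlt /= nth_rcons size_hist.
  by case/predU1P => [->|mN]; [rewrite ltnn eqxx | rewrite mN IH].
exists (fun N => x (hist N)) => N; have [xr xb] := xP (hist N).
rewrite size_hist in xr xb; split=> //; apply: le_trans xb _.
rewrite big_ord_recl subn0 le_eqVlt; apply/predU1P; left; do 2 f_equal.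
apply: eq_bigr => k _; have := ltn_ord k => kN.
by rewrite nth_hist //; lia.
Qed.

End Greedy.

(** * Growth of the weights, and divergence of the harmonic series *)

Section Multinom.
Variables (R : realType) (d : nat).
Implicit Types (w : word d) (i j : 'I_d).

Lemma multinom_nseq j m : multinom R (nseq m j) = 1.
Proof.
rewrite /multinom size_nseq (bigD1 j) //= count_nseq /= eqxx mul1n.
rewrite big1 ?muln1 ?mulfV ?pnatr_eq0 -?lt0n ?fact_gt0 // => i /negPf ij.
by rewrite count_nseq /= eq_sym ij.
Qed.

(** Let t be the number of letters [j] in [w]; the letter [i] forces t < |w|. Hence (|w|+N)!/(t+N)!
    is at least t+N+1, while the other letters contribute the factor 1/P for every N. *)
Lemma le_multinom_cat_nseq w i j : i \in w -> i != j ->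
  exists2 K : R, 0 < K & forall N, K * N.+1%:R <= multinom R (w ++ nseq N j).
Proof.
move=> iw ij; pose P := (\prod_(k < d | k != j) (count_mem k w)`!)%N.
have P0 : (0 < P)%N by rewrite prodn_gt0 // => k; rewrite fact_gt0.
exists P%:R^-1; first by rewrite invr_gt0 ltr0n.
move=> N; rewrite /multinom size_cat size_nseq (bigD1 j) //=.
rewrite count_cat count_nseq /= eqxx mul1n.
have -> : (\prod_(k < d | k != j) (count_mem k (w ++ nseq N j))`! = P)%N.
  apply: eq_bigr => k /negPf kj.
  by rewrite count_cat count_nseq /= eq_sym kj mul0n addn0.
set t := count_mem j w.
have tw : (t < size w)%N.
  rewrite -(count_predC (pred1 j) w) -[X in (X < _)%N]addn0 ltn_add2l -has_count.
  by apply/hasP; exists i.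
rewrite natrM invfM mulrA [leRHS]mulrC ler_pM2l ?invr_gt0 ?ltr0n //.
rewrite ler_pdivlMr ?ltr0n ?fact_gt0 // -natrM ler_nat.
have le_f : ((t + N).+1`! <= (size w + N)`!)%N by rewrite leq_fact // ltn_add2r.
apply: leq_trans le_f; by rewrite factS leq_mul2r ltnS leq_addl orbT.
Qed.

End Multinom.

Lemma harmonic_sum_unbounded (R : realType) (B : R) :
  exists M, B < \sum_(N < M) N.+1%:R^-1.
Proof.
apply: contrapT => /forallNP le_B; apply: (@dvg_harmonic R).
apply: nondecreasing_is_cvgn.
  by apply/nondecreasing_seqP => n;
    rewrite seriesEnat /= big_nat_recr //= lerDl invr_ge0.
exists B => _ [M _ <-]; rewrite seriesEnat /= big_mkord leNgt.
exact/negP/le_B.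
Qed.

(** * Coefficients of a multiplier, and constant functions *)

Section Multipliers.
Variables (R : realType) (d : nat).
Local Notation C := R[i].
Implicit Types (w : word d) (c : word d -> C) (f : graded_map R d).

(** Powers of one letter have weight 1, so the squared norm is bounded by the sum of 1/(N+1)^2. *)
Lemma power_series_H2 (j : 'I_d) (a : nat -> C) :
  (forall N, normc (a N) = N.+1%:R^-1) ->
  exists2 h, has_expansion h (power_coef j a) & H2 R d h.
Proof.
move=> aN; have [m|h he] := @power_series_exists R d j a.
  by rewrite aN invf_le1 // ler1n.
exists h => //; exists (power_coef j a); split=> //; apply/square_summableP.
exists 2 => J.
apply: le_trans (@fset_sum_nseq_le R d J j (fun m => m.+1%:R^-1 ^+ 2) 2 _ _).
- apply: ler_sum => w _; rewrite /power_coef; case: eqP => [wj|_].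
    by rewrite aN [in multinom R w]wj multinom_nseq mul1r.
  by rewrite normc0 expr0n mulr0.
- by move=> m; rewrite sqr_ge0.
- by move=> M; exact: inv_square_sum_le.
Qed.

Lemma multiplier_coef_eq0 (hd : (2 <= d)%N) f c :
  has_expansion f c -> (forall h, H2 R d h -> H2 R d (fun n X => f n X *m h n X)) ->
  forall w, w != [::] -> c w = 0.
Proof.
move=> fc fM [//|i w0] _; apply/eqP; apply: contrapT => /negP cw0.
pose P n := `[< exists w, [/\ size w = n, i \in w & c w != 0] >].
have exP : exists n, P n.
  by exists (size (i :: w0)); apply/asboolP; exists (i :: w0);
    rewrite mem_head.
have [_ /asboolP[b [<- ib cb]] bmin] := ex_minnP exP.
have cmin w : i \in w -> (size w < size b)%N -> c w = 0.
  move=> iw wb; apply/eqP; apply: contrapT => /negP cw.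
  have : P (size w) by apply/asboolP; exists w.
  by move/bmin; rewrite leqNgt wb.
have [j ij] : exists j, i != j.
  have [->|i0] := eqVneq i (Ordinal (ltnW hd)); first by exists (Ordinal hd).
  by exists (Ordinal (ltnW hd)).
have [N|a aP] := @greedy_convolution R (fun s => c (b ++ nseq s j))
    (fun N => N.+1%:R^-1).
  by rewrite invr_ge0.
have [|h he hH] := @power_series_H2 j a; first by move=> N; have [] := aP N.
have [g [/square_summableP[B gB] fhg]] := fM _ hH.
(* A cut inside [b] contributes 0: either [i] lies in the left part, which is shorter than [b], so
   [c] vanishes there by minimality; or [i] lies in the right part, which is then not a power of
   [j]. *)
have gE N : g (b ++ nseq N j) = \sum_(s < N.+1) c (b ++ nseq s j) * a (N - s)%N.
  rewrite (coef_mul _ fc he fhg) size_cat size_nseq.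
  rewrite -(big_mkord xpredT (fun l => c (take l _) * power_coef j a (drop l _))).
  rewrite (big_cat_nat (n := size b)) //=; last by rewrite leqW // leq_addr.
  rewrite big_nat_cond big1 ?add0r => [|l]; last first.
    rewrite andbT /= => lb; rewrite take_cat drop_cat lb.
    have [it|it] := boolP (i \in take l b).
      by rewrite cmin ?mul0r // size_take lb.
    have id : i \in drop l b.
      by move: ib; rewrite -{1}(cat_take_drop l b) mem_cat (negPf it).
    rewrite /power_coef; case: eqP => [E|]; last by rewrite mulr0.
    have : i \in drop l b ++ nseq N j by rewrite mem_cat id.
    by rewrite E mem_nseq (negPf ij) andbF.
  rewrite -{1}[size b]add0n big_addn -addnS addKn big_mkord.
  apply: eq_bigr => s _; rewrite take_cat drop_cat ltnNge leq_addl /= addnK take_nseq -1?ltnS //.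
  by rewrite drop_nseq /power_coef size_nseq eqxx.
have [K K0 leK] := le_multinom_cat_nseq R ib ij.
(* The weight K(N+1) times the square of |c b|/(N+1) is D/(N+1), a harmonic term. *)
pose D := K * normc (c b) ^+ 2.
have D0 : 0 < D.
  rewrite mulr_gt0 // exprn_gt0 // lt_def normc_ge0 andbT.
  by apply: contra cb => /eqP/eq0_normc ->.
have [M] := harmonic_sum_unbounded (B / D); rewrite ltNge => /negP; apply.
rewrite ler_pdivlMr // mulr_suml.
(* These words have different lengths, so the sum over [J] is a sum over [N < M]. *)
pose J := [fset b ++ nseq (N : 'I_M) j | N in 'I_M]%fset.
apply: le_trans (gB J); rewrite big_imfset /=; last first.
  move=> N N' _ _ /eqP; rewrite eqseq_cat // eqxx /= => /eqP /(congr1 size).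
  by rewrite !size_nseq => /val_inj.
rewrite big_enum /=; apply: ler_sum => N _; have [_] := aP N.
rewrite -gE cats0 => le_g.
have -> : N.+1%:R^-1 * D = (K * N.+1%:R) * (normc (c b) * N.+1%:R^-1) ^+ 2.
  by rewrite /D; field; rewrite addrC natr1.
apply: ler_pM (leK N) _; rewrite ?sqr_ge0 ?mulr_ge0 ?(ltW K0) ?normc_ge0 //.
by rewrite ler_pXn2r ?nnegrE ?mulr_ge0 ?normc_ge0 ?invr_ge0.
Qed.

(** Only the empty word contributes, so every finite sum over a set containing it already equals
    [a%:M]. *)
Lemma constant_expansion (a : C) c f :
  (forall w, c w = if w == [::] then a else 0) ->
  has_expansion f c <-> forall n (X : polydisk R d n), f n X = a%:M.
Proof.
move=> cE; have sumE (J : {fset word d}) n (X : polydisk R d n) i k : [::] \in J ->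
    \sum_(w <- J) (c w *: word_prod (val X) w) i k = (a%:M : 'M_n) i k.
  move=> J0; rewrite (bigD1_seq _ J0) ?fset_uniq //= big1 => [|w /negPf w0].
    by rewrite addr0 cE eqxx /word_prod big_nil scalemx1.
  by rewrite cE w0 scale0r mxE.
split=> [fc n X|fa n X].
  have /mx_partial_sumP fX := fc n X; apply/matrixP => i k.
  apply/eqP; rewrite -subr_eq0; apply/eqP/eq0_normc/eqP.
  rewrite eq_le normc_ge0 andbT leNgt; apply/negP => /fX[J0].
  move=> /(_ ([::] |` J0)%fset (fsubsetUr _ _) i k).
  by rewrite sumE ?ltxx // !inE eqxx.
apply/mx_partial_sumP => e e0; exists [fset [::]]%fset => J J0 i k.
rewrite sumE ?fa ?subrr ?normc0 //.
by apply: (fsubsetP J0); rewrite inE.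
Qed.

Lemma one_H2 : H2 R d (nc_one R d).
Proof.
pose c w : C := if w == [::] then 1 else 0; exists c; split; last first.
  exact/(constant_expansion (a := 1)).
apply/square_summableP; exists 1 => J.
have multinom_nil : multinom R ([::] : word d) = 1.
  rewrite /multinom /= big1 ?divr1 // => i _.
have [J0|J0] := boolP ([::] \in J).
  rewrite (bigD1_seq _ J0) ?fset_uniq // big1 => [|w /negPf w0].
    by rewrite /c eqxx multinom_nil normc1 expr1n mulr1 /= addr0.
  by rewrite /c w0 normc0 expr0n mulr0.
rewrite big_seq big1 // => w wJ; rewrite /c; case: eqP => [w0|].
  by move: J0; rewrite -w0 wJ.
by rewrite normc0 expr0n mulr0.
Qed.

Lemma scale_H2 (a : C) f : H2 R d f -> H2 R d (fun n X => a *: f n X).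
Proof.
move=> [c [/square_summableP[B cB] fc]]; exists (fun w => a * c w); split.
  apply/square_summableP; exists (normc a ^+ 2 * B) => J.
  apply: le_trans (ler_wpM2l (sqr_ge0 _) (cB J)).
  by rewrite mulr_sumr ler_sum // => w _; rewrite normcM exprMn mulrCA.
move=> n X; apply/mx_partial_sumP => e e0.
(* Dividing the tolerance by |a| + 1 instead of |a| covers [a = 0] as well. *)
have D0 : 0 < normc a + 1 by rewrite ltr_wpDl ?normc_ge0.
have /mx_partial_sumP/(_ (e / (normc a + 1))) [|J0 J0P] := fc n X.
  by rewrite divr_gt0.
exists J0 => J /J0P JP i k; have := JP i k.
under [in X in _ -> X]eq_bigr do rewrite -scalerA mxE.
rewrite mxE -mulr_sumr -mulrBr normcM ltr_pdivlMr //; apply: le_lt_trans.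
by rewrite mulrC ler_wpM2l ?normc_ge0 // lerDl.
Qed.

End Multipliers.

Theorem theorem2p7 (R : realType) (d : nat) (hd : (2 <= d)%N) :
  Mult R d = [set (fun n X => c *: nc_one R d n X) | c in [set: R[i]]].
Proof.
apply/seteqP; split=> [f [_ fM]|_ [a _ <-]].
  have [c [_ fc]] : H2 R d f.
    have := fM _ (one_H2 R d).
    congr (H2 R d _); apply: functional_extensionality_dep => n.
    by apply/funext => X; rewrite mulmx1.
  exists (c [::]) => //; apply: functional_extensionality_dep => n.
  apply/funext => X; rewrite /nc_one scalemx1; apply/esym.
  apply: ((constant_expansion (a := c [::]) (c := c) _ _).1 fc) => w.
  by case: eqP => [->//|/eqP]; exact: multiplier_coef_eq0.
(* Conversely, a scalar multiple of 1 acts on [H2] by scaling, and it is an nc function because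
   scalar matrices split into blocks and commute with [S]. *)
split; last first.
  move=> h hH; have := scale_H2 a hH; congr (H2 R d _).
  apply: functional_extensionality_dep => n.
  by apply/funext => X; rewrite -scalemxAl mul1mx.
split=> [m n X Y W _|n S X Y Su _]; rewrite /nc_one !scalemx1.
  by rewrite scalar_mx_block.
by rewrite scalar_mxC -mulmxA mulVmx ?mulmx1.
Qed.
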